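(* Let $X$ be a Hilbert space, let $H_0\colon D(H_0)\subseteq X\to X$ be a densely defined, closed, skew-symmetric operator, and let $(\Omega,\mathcal{G}_1,\mathcal{G}_2,F,\omega)$ be a boundary system for $H_0$ in which $\Omega$ is the standard symmetric form and $\omega$ is the standard unitary form. Let $H\colon D(H)\subseteq X\to X$ be a linear operator that is a restriction of $H_0^{\star}$. Then $H$ is a maximal dissipative extension of $-H_0$ if and only if there exists a (linear) contraction $T\colon\mathcal{G}_2\to\mathcal{G}_1$ such that $$D(H)=\{x\in D(H_0^{\star})\;:\;F_1(x)=TF_2(x)\}.$$
   Context: Operators are linear. $H_0$ is skew-symmetric if $H_0\subseteq -H_0^{\star}$. An operator $H$ in $X$ is dissipative if $\operatorname{Re}\langle Hx,x\rangle\leqslant 0$ for all $x\in D(H)$; it is maximal dissipative if it is dissipative and every dissipative operator $K$ extending $H$ satisfies $K=H$. A contraction is a linear operator, defined everywhere, of norm at most $1$. A boundary system for $H_0$ is a quintuple $(\Omega,\mathcal{G}_1,\mathcal{G}_2,F,\omega)$ consisting of Hilbert spaces $\mathcal{G}_1,\mathcal{G}_2$, sesquilinear forms $\Omega\colon (X\oplus X)\times(X\oplus X)\to\mathbb{C}$ and $\omega\colon(\mathcal{G}_1\oplus\mathcal{G}_2)\times(\mathcal{G}_1\oplus\mathcal{G}_2)\to\mathbb{C}$, and a linear surjective map $F\colon\operatorname{Graph}(H_0^{\star})\to\mathcal{G}_1\oplus\mathcal{G}_2$ such that $\Omega((x,H_0^{\star}x),(y,H_0^{\star}y))=\omega(F(x,H_0^{\star}x),F(y,H_0^{\star}y))$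 for all $x,y\in D(H_0^{\star})$. The standard symmetric form is $\Omega((x,y),(u,v))=\langle x,v\rangle_X+\langle y,u\rangle_X$ and the standard unitary form is $\omega((x,y),(u,v))=\langle x,u\rangle_{\mathcal{G}_1}-\langle y,v\rangle_{\mathcal{G}_2}$. For $i\in\{1,2\}$, $F_i\colon D(H_0^{\star})\to\mathcal{G}_i$ is defined by $F_ix=\operatorname{pr}_i(F(x,H_0^{\star}x))$, where $\operatorname{pr}_i\colon\mathcal{G}_1\oplus\mathcal{G}_2\to\mathcal{G}_i$ is the canonical projection. *)

(* Defs.v *)
From HB Require Import structures.
From mathcomp Require Import all_boot all_order all_algebra.
From mathcomp Require Import complex.
From mathcomp Require Import all_classical all_reals all_analysis.

Set Implicit Arguments.
Unset Strict Implicit.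
Unset Printing Implicit Defensive.

Import Order.TTheory GRing.Theory Num.Theory.
Import numFieldNormedType.Exports.

Local Open Scope classical_set_scope.
Local Open Scope ring_scope.
Local Open Scope complex_scope.

(* Sesquilinear forms are linear in the first argument and conjugate-linear in
   the second one. *)
Definition sesquilinear (R : realType) (U : lmodType R[i]) : Type :=
  {bilinear U -> U -> R[i] | *%R & Num.conj \; *%R}.

HB.mixin Record isHilbert (R : realType) V & CompleteNormedModule R[i] V := {
  inner : {dot V for (@Num.conj R[i])} ;
  inner_normE : forall x : V, inner x x = `|x| ^+ 2
}.

#[short(type="hilbertType")]
HB.structure Definition Hilbert (R : realType) :=
  {V of CompleteNormedModule R[i] V & isHilbert R V}.

(* An operator in X is identified with its graph. *)
Record operator (R : realType) (X : hilbertType R) := Operator {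
  graph : set (X * X) ;
  graph0 : graph 0 ;
  graphP : forall (a : R[i]) p q, graph p -> graph q -> graph (a *: p + q) ;
  graph_fun : forall x y z, graph (x, y) -> graph (x, z) -> y = z
}.

Section operators.
Context {R : realType} {X : hilbertType R}.
Implicit Types H K : operator X.

Definition dom H : set X := [set x | exists y, graph H (x, y)].

(* The value is meaningful for x in dom H only, and is 0 elsewhere. *)
Definition opval H (x : X) : X := xget 0 [set y | graph H (x, y)].
Coercion opval : operator >-> Funclass.

(* extends K H: K is the larger operator. *)
Definition extends K H := graph H `<=` graph K.

Definition closed_operator H := closed (graph H).

Definition densely_defined H := dense (dom H).

Definition dissipative H := forall x, dom H x -> 'Re (inner (H x) x) <= 0.

Definition maximal_dissipative H :=
  dissipative H /\ forall K, dissipative K -> extends K H -> K = H.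

Lemma graph_opval H x : dom H x -> graph H (x, H x).
Proof.
by move=> [y Hxy]; apply: (@xgetPex _ 0 [set z | graph H (x, z)]); exists y.
Qed.

Lemma opvalE H x y : graph H (x, y) -> H x = y.
Proof.
move=> Hxy; have Hx : graph H (x, H x) by apply: graph_opval; exists y.
exact: graph_fun Hx Hxy.
Qed.

Lemma operator_ext H K : graph H = graph K -> H = K.
Proof.
case: H K => [G G0 GP Gf] [L L0 LP Lf] /= E; case: _ / E in L0 LP Lf *.
by congr Operator; exact: Prop_irrelevance.
Qed.

Definition opp_graph H : set (X * X) := [set p | graph H (p.1, - p.2)].

Lemma opp_graph0 H : opp_graph H 0.
Proof. by rewrite /opp_graph /= oppr0; exact: graph0. Qed.

Lemma opp_graphP H (a : R[i]) p q :
  opp_graph H p -> opp_graph H q -> opp_graph H (a *: p + q).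
Proof.
rewrite /opp_graph /= => Hp Hq; rewrite opprD -scalerN.
exact: (graphP a Hp Hq).
Qed.

Lemma opp_graph_fun H x y z :
  opp_graph H (x, y) -> opp_graph H (x, z) -> y = z.
Proof. by move=> /= Hy Hz; apply: oppr_inj; exact: graph_fun Hy Hz. Qed.

Definition opp_operator H : operator X :=
  Operator (@opp_graph0 H) (@opp_graphP H) (@opp_graph_fun H).

Definition adjoint_graph H : set (X * X) :=
  [set p | forall x, dom H x -> inner (H x) p.1 = inner x p.2].

Lemma adjoint_graph0 H : adjoint_graph H 0.
Proof. by move=> x _ /=; rewrite !linear0r. Qed.

Lemma adjoint_graphP H (a : R[i]) p q :
  adjoint_graph H p -> adjoint_graph H q -> adjoint_graph H (a *: p + q).
Proof.
move=> Hp Hq x xH /=; rewrite !linearDr !linearZr_LR /=.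
by rewrite (Hp x xH) (Hq x xH).
Qed.

Lemma adjoint_graph_fun H : densely_defined H ->
  forall x y z, adjoint_graph H (x, y) -> adjoint_graph H (x, z) -> y = z.
Proof.
move=> dH x y z Hy Hz; apply/eqP; rewrite -subr_eq0; apply/negPn/negP => w0.
set w := y - z in w0.
have w_gt0 : 0 < `|w| by rewrite normr_gt0.
have [|v [wv vH]] := dH (ball w `|w|) _ (ball_open w `|w|).
  by exists w; exact: ballxx.
have vw : inner v w = 0 by rewrite linearBr /= -(Hy _ vH) -(Hz _ vH) subrr.
have wv0 : inner w v = 0 by apply/eqP; rewrite herm_eq0C; apply/eqP.
move: wv; rewrite -ball_normE /= => wv.
have : `|w - v| ^+ 2 < `|w| ^+ 2 by rewrite ltr_pXn2r // nnegrE.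
have -> : `|w - v| ^+ 2 = `|w| ^+ 2 + `|v| ^+ 2.
  by rewrite -!inner_normE (@hnormBd _ _ _ _ inner w v wv0).
by rewrite gtrDl le_gtF ?exprn_ge0.
Qed.

Definition adjoint H (dH : densely_defined H) : operator X :=
  Operator (@adjoint_graph0 H) (@adjoint_graphP H) (adjoint_graph_fun dH).

Definition skew_symmetric H (dH : densely_defined H) :=
  extends (opp_operator (adjoint dH)) H.

End operators.

Record boundary_system (R : realType) (X : hilbertType R) (H0 : operator X)
    (dH0 : densely_defined H0) := BoundarySystem {
  bs_G1 : hilbertType R ;
  bs_G2 : hilbertType R ;
  bs_Omega : sesquilinear (X * X)%type ;
  bs_omega : sesquilinear (bs_G1 * bs_G2)%type ;
  (* only the restriction of bs_F to the graph of the adjoint matters *)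
  bs_F : X * X -> bs_G1 * bs_G2 ;
  bs_F_linear : forall (a : R[i]) p q,
    graph (adjoint dH0) p -> graph (adjoint dH0) q ->
    bs_F (a *: p + q) = a *: bs_F p + bs_F q ;
  bs_F_surj : set_surj (graph (adjoint dH0)) setT bs_F ;
  bs_form : forall x y, dom (adjoint dH0) x -> dom (adjoint dH0) y ->
    bs_Omega (x, adjoint dH0 x) (y, adjoint dH0 y) =
    bs_omega (bs_F (x, adjoint dH0 x)) (bs_F (y, adjoint dH0 y))
}.

Section boundary_systems.
Context {R : realType} {X : hilbertType R} {H0 : operator X}.
Context {dH0 : densely_defined H0}.

Definition bs_F1 (B : boundary_system dH0) (x : X) : bs_G1 B :=
  (bs_F B (x, adjoint dH0 x)).1.

Definition bs_F2 (B : boundary_system dH0) (x : X) : bs_G2 B :=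
  (bs_F B (x, adjoint dH0 x)).2.

End boundary_systems.

Section standard_forms.
Context {R : realType}.

Definition standard_symmetric (X : hilbertType R) (p q : X * X) : R[i] :=
  inner p.1 q.2 + inner p.2 q.1.

Definition standard_unitary (G1 G2 : hilbertType R) (p q : G1 * G2) : R[i] :=
  inner p.1 q.1 - inner p.2 q.2.

Lemma standard_symmetric_sesquilinear (X : hilbertType R) :
  bilinear_for *%R (Num.conj \; *%R) (@standard_symmetric X).
Proof.
split=> [q|p] a u v; rewrite /standard_symmetric /= ?linearPl ?linearPr /=.
- by rewrite mulrDr addrACA.
- by rewrite mulrDr addrACA.
Qed.

HB.instance Definition _ (X : hilbertType R) :=
  bilinear_isBilinear.Build R[i] (X * X)%type (X * X)%type R[i]
    *%R (Num.conj \; *%R) (@standard_symmetric X)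
    (standard_symmetric_sesquilinear X).

Lemma standard_unitary_sesquilinear (G1 G2 : hilbertType R) :
  bilinear_for *%R (Num.conj \; *%R) (@standard_unitary G1 G2).
Proof.
split=> [q|p] a u v; rewrite /standard_unitary /= ?linearPl ?linearPr /=.
- by rewrite mulrBr opprD addrACA.
- by rewrite mulrBr opprD addrACA.
Qed.

HB.instance Definition _ (G1 G2 : hilbertType R) :=
  bilinear_isBilinear.Build R[i] (G1 * G2)%type (G1 * G2)%type R[i]
    *%R (Num.conj \; *%R) (@standard_unitary G1 G2)
    (standard_unitary_sesquilinear G1 G2).

End standard_forms.

Definition contraction_operator (R : realType) (G K : hilbertType R)
    (T : {linear G -> K}) :=
  forall v, `|T v| <= `|v|.

(* Main.v *)
From HB Require Import structures.
Require Import Defs.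
From mathcomp Require Import all_boot all_order all_algebra.
From mathcomp Require Import complex.
From mathcomp Require Import all_classical all_reals all_analysis.
From mathcomp Require Import ring lra.

(* Write A for the adjoint of H0. Green's identity reads
   2 Re <A x, x> = |F1 x|^2 - |F2 x|^2, so a restriction of A is dissipative
   exactly when |F1 x| <= |F2 x| on its domain.
   If H is maximal dissipative, F2 maps D(H) onto G2: for v in G2 there is t in
   G1 such that adjoining (t, v) to F(D(H)) keeps |F1| <= |F2|, and since F is
   surjective this would extend H dissipatively unless (t, v) is already
   attained. The contraction T sends F2 x to F1 x, and maximality again puts
   every x with F1 x = T (F2 x) in D(H).
   Conversely, -H0 lies in the kernel of F, and a dissipative extension K of
   -H0 is a restriction of A because <H0 x, x> is imaginary. For y in D(K),
   surjectivity of F gives x in D(H) with F2 x = F2 y; then F2 (y - x) = 0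
   forces F1 (y - x) = 0, hence y is in D(H). *)

Set Implicit Arguments.
Unset Strict Implicit.
Unset Printing Implicit Defensive.

Import Order.TTheory GRing.Theory Num.Theory.
Import numFieldNormedType.Exports.

Local Open Scope classical_set_scope.
Local Open Scope ring_scope.
Local Open Scope complex_scope.

(** * Real parts of inner products and squared norms *)

Section real_inner.
Context {R : realType} {V : hilbertType R}.
Implicit Types (x y z : V) (r : R).

(** Values lie in [R] rather than [R[i]], so that estimates take place in a totally ordered
    field. *)
Definition rinner x y : R := complex.Re (inner x y).

Definition sqn x : R := rinner x x.

Lemma rinnerC x y : rinner x y = rinner y x.
Proof.
rewrite /rinner (hermC inner x y) expr0 mul1r /=.
by case: (inner y x).
Qed.

Lemma rinnerDl x y z : rinner (x + y) z = rinner x z + rinner y z.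
Proof. by rewrite /rinner linearDl raddfD. Qed.

Lemma rinnerDr x y z : rinner z (x + y) = rinner z x + rinner z y.
Proof. by rewrite rinnerC rinnerDl !(rinnerC z). Qed.

Lemma rinnerNl x y : rinner (- x) y = - rinner x y.
Proof. by rewrite /rinner linearNl raddfN. Qed.

Lemma rinnerNr x y : rinner x (- y) = - rinner x y.
Proof. by rewrite rinnerC rinnerNl rinnerC. Qed.

Lemma rinnerZl r x y : rinner (r%:C *: x) y = r * rinner x y.
Proof.
rewrite /rinner linearZl_LR /=.
by case: (inner x y) => a b /=; rewrite mul0r subr0.
Qed.

Lemma rinnerZr r x y : rinner x (r%:C *: y) = r * rinner x y.
Proof. by rewrite rinnerC rinnerZl rinnerC. Qed.

Definition rinnerE :=
  (rinnerDl, rinnerDr, rinnerNl, rinnerNr, rinnerZl, rinnerZr).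

Lemma sqnE x : (sqn x)%:C = `|x| ^+ 2.
Proof.
rewrite -inner_normE /sqn /rinner RRe_real// inner_normE.
by rewrite ger0_real// exprn_ge0.
Qed.

Lemma sqn_ge0 x : 0 <= sqn x.
Proof. by rewrite -lecR sqnE exprn_ge0. Qed.

Lemma sqn_eq0 x : sqn x = 0 -> x = 0.
Proof.
by move=> x0; apply/eqP; rewrite -normr_eq0 -sqrf_eq0 -sqnE x0.
Qed.

End real_inner.

(** * Completeness and estimates for squared norms *)

Lemma ler_sqn (R : realType) (V W : hilbertType R) (x : V) (y : W) :
  (sqn x <= sqn y) = (`|x| <= `|y|).
Proof. by rewrite -lecR !sqnE ler_pXn2r ?nnegrE. Qed.

Lemma cauchy_sqn_cvg (R : realType) (V : hilbertType R) (u : nat -> V) :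
  (forall e : R, 0 < e ->
     exists N, forall i j, (N <= i)%N -> (N <= j)%N -> sqn (u i - u j) < e) ->
  exists l, forall e : R, 0 < e ->
    exists N, forall i, (N <= i)%N -> sqn (l - u i) < e.
Proof.
have sqn_lt (x : V) (e : R) : 0 < e -> (sqn x < e ^+ 2) = (`|x| < e%:C).
  move=> e0; rewrite -ltcR sqnE rmorphXn ltr_pXn2r ?nnegrE//.
  by rewrite lecR ltW.
move=> uC; have uCauchy : cauchy (u @ \oo).
  apply: (@cauchy_exP R[i]) => _e _e0.
  (* A positive element of [R[i]] is real, so the radius comes from some [e] in [R]. *)
  have /complex_realP[e eE] := gtr0_real _e0.
  have e0 : 0 < e by rewrite -ltcR -eE.
  rewrite eE.
  have [N uN] := uC _ (exprn_gt0 2 e0).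
  exists (u N); exists N => // i /= Ni.
  by rewrite -ball_normE /ball_ /= -sqn_lt//; exact: uN.
have /cvg_ex[l ul] : cvg (u @ \oo) by exact: cauchy_cvg.
exists l => e e0.
have s0 : 0 < Num.sqrt e by rewrite sqrtr_gt0.
have [|N _ uN] := (@cvgrPdist_lt R[i] _ _ _ _ u l).1 ul (Num.sqrt e)%:C.
  by rewrite ltcR.
by exists N => i Ni; rewrite -(sqr_sqrtr (ltW e0)) sqn_lt//; exact: uN.
Qed.

(** Replaces a passage to the limit [s -> 0]. If [b < a], the hypothesis says
    [a - b <= s * (a + b + 2 + s)], which fails for [s = (a - b) / (a + b + 4)] since [s < 1]. *)
Lemma ler_of_perturbed (R : realType) (a b : R) : 0 <= a -> 0 <= b ->
  (forall s, 0 < s -> s < 1 -> (1 - s) * a <= (1 + s) * (b + s) + s) -> a <= b.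
Proof.
move=> a0 b0 ab; rewrite leNgt; apply/negP => ba.
have D0 : 0 < a + b + 4 by rewrite ltr_wpDl// addr_ge0.
set s := (a - b) / (a + b + 4).
have sD : s * (a + b + 4) = a - b by rewrite /s divfK// gt_eqF.
have s0 : 0 < s by rewrite divr_gt0// subr_gt0.
have s1 : s < 1 by rewrite ltr_pdivrMr//; lra.
have ss : s * s < s by rewrite gtr_pMr.
have := ab _ s0 s1; lra.
Qed.

Lemma sqn_subC (R : realType) (V : hilbertType R) (x y : V) :
  sqn (x - y) = sqn (y - x).
Proof. by rewrite /sqn !rinnerE (rinnerC y x); ring. Qed.

(** The right side minus the left side is [s^-1 * sqn (s w - d)]. *)
Lemma ler_sqnD (R : realType) (V : hilbertType R) (d w : V) (s : R) :
  0 < s -> sqn (d + w) <= (1 + s) * sqn w + (1 + s^-1) * sqn d.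
Proof.
move=> s0; have := sqn_ge0 (s%:C *: w - d).
rewrite /sqn !rinnerE (rinnerC d w) => H.
rewrite -subr_ge0.
have -> : (1 + s) * rinner w w + (1 + s^-1) * rinner d d -
  (rinner d d + rinner w d + (rinner w d + rinner w w)) =
  s^-1 * (s * (s * rinner w w - rinner w d) - (s * rinner w d - rinner d d)).
  by field; rewrite gt_eqF.
by rewrite mulr_ge0// ?invr_ge0 ltW.
Qed.

Lemma sqn_convex (R : realType) (V : hilbertType R) (x y : V) (s : R) :
  sqn ((1 - s)%:C *: x + s%:C *: y) =
  (1 - s) * sqn x + s * sqn y - s * (1 - s) * sqn (x - y).
Proof. by rewrite /sqn !rinnerE (rinnerC y x); ring. Qed.

(* A minimizing sequence for the distance from [v] to the second projection of
   [S] is Cauchy in both components, and [t] is the limit of its first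
   components. *)
Lemma contraction_point (R : realType) (G1 G2 : hilbertType R)
    (S : set (G1 * G2)) (v : G2) :
  S 0 -> (forall (a : R[i]) p q, S p -> S q -> S (a *: p + q)) ->
  (forall p, S p -> `|p.1| <= `|p.2|) ->
  exists t, forall p, S p -> `|t - p.1| <= `|v - p.2|.
Proof.
move=> S0 SP Sc.
pose E := [set sqn (v - p.2) | p in S].
have lbE : has_lbound E by exists 0 => _ [p _ <-]; exact: sqn_ge0.
have infE : has_inf E by split=> //; exists (sqn (v - 0)), 0.
have dE p : S p -> inf E <= sqn (v - p.2).
  by move=> Sp; apply: ge_inf => //; exists p.
have mE (n : nat) : exists p, S p /\ sqn (v - p.2) < inf E + n.+1%:R^-1.
  have [|_ [p Sp <-] pE] := @inf_adherent _ _ n.+1%:R^-1 _ infE.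
    by rewrite invr_gt0.
  by exists p.
have {mE}[m mE] := choice mE.
have mS n : S (m n) := (mE n).1.
have SB p q : S p -> S q -> S (p - q).
  by move=> Sp Sq; rewrite addrC -scaleN1r; exact: SP.
have Sconv p q (s : R) : S p -> S q -> S ((1 - s)%:C *: p + s%:C *: q).
  by move=> Sp Sq; apply: (SP) => //; rewrite -[_ *: q]addr0; exact: SP.
(* The convex combination of [p] and [q] lies in [S], so its distance is at least [inf E]. In the
   convexity identity, the contraction bound on [S] lets first components replace second ones. *)
have key p q (s : R) : S p -> S q ->
    0 <= s -> s <= 1 -> inf E + s * (1 - s) * sqn (p.1 - q.1) <=
    (1 - s) * sqn (v - p.2) + s * sqn (v - q.2).
  move=> Sp Sq s0 s1; have := dE _ (Sconv _ _ s Sp Sq) => /=.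
  have -> : v - ((1 - s)%:C *: p.2 + s%:C *: q.2) =
      (1 - s)%:C *: (v - p.2) + s%:C *: (v - q.2).
    rewrite !scalerBr addrACA -scalerDl -rmorphD subrK scale1r.
    by rewrite opprD.
  have vpq : v - p.2 - (v - q.2) = q.2 - p.2 by rewrite opprB addrC addrA subrK.
  rewrite sqn_convex vpq (sqn_subC q.2) => E1.
  have pq : sqn (p.1 - q.1) <= sqn (p.2 - q.2).
    by rewrite ler_sqn; exact: Sc (SB _ _ Sp Sq).
  have s1' : 0 <= s * (1 - s) by rewrite mulr_ge0// subr_ge0.
  by have := ler_wpM2l s1' pq; lra.
have : exists t, forall e : R, 0 < e ->
    exists N, forall i, (N <= i)%N -> sqn (t - (m i).1) < e.
  apply: cauchy_sqn_cvg => e e0.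
  have e4 : 0 < e / 4 by rewrite divr_gt0.
  have [N _ HN] := near_infty_natSinv_lt (PosNum e4); exists N => i j Ni Nj.
  (* At the midpoint, a quarter of the squared distance of first components is at most the mean
     excess over [inf E]. *)
  have := key _ _ (2^-1) (mS i) (mS j).
  have half0 : 0 <= 2^-1 :> R by rewrite invr_ge0.
  have half1 : 2^-1 <= 1 :> R by lra.
  move=> /(_ half0 half1).
  move: (HN _ Ni) (HN _ Nj) (mE i).2 (mE j).2 => /=.
  set ei := i.+1%:R^-1; set ej := j.+1%:R^-1; lra.
move=> [t tm]; exists t => p Sp; rewrite -ler_sqn.
apply: ler_of_perturbed; rewrite ?sqn_ge0// => s s0 s1.
(* Errors below [s * s] remain of order [s] after division by [s], both in [key] with weight [s] and
   in [ler_sqnD]. *)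
have [N _ HN] := near_infty_natSinv_lt (PosNum (mulr_gt0 s0 s0)).
have [N' HN'] := tm _ (mulr_gt0 s0 s0).
pose i := maxn N N'.
have mi := (mE i).2.
have {HN}mi' := HN _ (leq_maxl N N').
have {HN'}ti := HN' _ (leq_maxr N N').
have := ler_sqnD (t - (m i).1) ((m i).1 - p.1) s0.
rewrite -addrA (addrA (- _)) addNr add0r.
have := key _ _ s (mS i) Sp (ltW s0) (ltW s1).
have infE0 : 0 <= inf E by apply: lb_le_inf => [|_ [q _ <-]];
  [case: infE | exact: sqn_ge0].
move: mi mi' ti (sqn_ge0 (t - (m i).1)); rewrite /= -/i.
set A := sqn (t - p.1); set X := sqn ((m i).1 - p.1); set b := sqn (v - p.2).
set D := sqn (t - _); set e := i.+1%:R^-1; set d := inf E.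
move=> mi es Ds D0 H1 H2.
have s1' : 0 <= 1 - s by rewrite subr_ge0 ltW.
have X1 : (1 - s) * X <= s + b.
  rewrite -(ler_pM2l s0).
  have := ler_wpM2l s1' (ltW mi).
  have := ler_wpM2l (ltW s0) infE0; nra.
have D1 : (1 + s^-1) * D <= s + s * s.
  have -> : s + s * s = (1 + s^-1) * (s * s) by field; rewrite gt_eqF.
  by apply: ler_wpM2l; [rewrite addr_ge0// invr_ge0 ltW | exact: ltW].
have := ler_wpM2l s1' H2.
nra.
Qed.

(** * Dissipative extensions and the adjoint *)

Section operator_graphs.
Context {R : realType} {X : hilbertType R}.
Implicit Types (H K A : operator X) (p q : X * X).

Lemma graphZ H (a : R[i]) p : graph H p -> graph H (a *: p).
Proof. by move=> Hp; rewrite -[_ *: _]addr0; exact: graphP Hp (graph0 H). Qed.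

Lemma graphD H p q : graph H p -> graph H q -> graph H (p + q).
Proof. by rewrite -{2}[p]scale1r; exact: graphP. Qed.

Lemma graphB H p q : graph H p -> graph H q -> graph H (p - q).
Proof. by move=> Hp Hq; rewrite addrC -scaleN1r; exact: graphP. Qed.

Lemma graph_opvalK H p : graph H p -> (p.1, H p.1) = p.
Proof. by case: p => x y /= Hxy; rewrite (opvalE Hxy). Qed.

Lemma dissipativeP H :
  dissipative H <-> forall p, graph H p -> rinner p.2 p.1 <= 0.
Proof.
split=> [dH p Hp|dH x Hx].
  have := dH p.1 (ex_intro _ p.2 _); rewrite -surjective_pairing => /(_ Hp).
  by rewrite -complexRe lecR -[H p.1]/((p.1, H p.1).2) graph_opvalK.
by rewrite -complexRe lecR; exact: dH (graph_opval Hx).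
Qed.

(** The span of [graph H] and [p] lies in [graph A], hence is single-valued; it is a dissipative
    extension of [H], so maximality makes it equal to [H]. *)
Lemma maximal_dissipative_mem A H p : extends A H -> maximal_dissipative H ->
  graph A p ->
  (forall h (c : R[i]), graph H h ->
    rinner (h + c *: p).2 (h + c *: p).1 <= 0) ->
  graph H p.
Proof.
move=> HA [_ Hmax] Ap Hp.
pose g := [set q | exists h (c : R[i]), graph H h /\ q = h + c *: p].
have g0 : g 0 by exists 0, 0; rewrite scale0r addr0; split=> //; exact: graph0.
have gP (a : R[i]) q r : g q -> g r -> g (a *: q + r).
  move=> [h [c [Hh ->]]] [h' [c' [Hh' ->]]].
  exists (a *: h + h'), (a * c + c'); split; first exact: graphP.
  by rewrite scalerDr scalerDl scalerA addrACA.
have gA q : g q -> graph A q.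
  by move=> [h [c [Hh ->]]]; apply: graphD; [exact: HA | exact: graphZ].
have gf x y z : g (x, y) -> g (x, z) -> y = z.
  by move=> /gA xy /gA xz; exact: graph_fun xy xz.
pose K := Operator g0 gP gf.
have <- : K = H.
  apply: Hmax; first by apply/dissipativeP => q [h [c [Hh ->]]]; exact: Hp.
  by move=> h Hh; exists h, 0; rewrite scale0r addr0.
by exists 0, 1; rewrite scale1r add0r; split=> //; exact: graph0.
Qed.

(* [Re <K (r p + q), r p + q>] is affine in [r] and nonpositive, hence
   constant. *)
Lemma dissipative_cross_eq0 K p q : dissipative K -> graph K p -> graph K q ->
  rinner p.2 p.1 = 0 -> rinner p.2 q.1 + rinner p.1 q.2 = 0.
Proof.
move=> /dissipativeP dK Kp Kq p0; set l := _ + _.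
have H (r : R) : rinner q.2 q.1 + r * l <= 0.
  have := dK _ (graphP (r%:C) Kp Kq) => /=.
  rewrite !rinnerE p0 (rinnerC q.2 p.1) /l.
  by apply: le_trans; rewrite le_eqVlt; apply/orP; left; apply/eqP; ring.
apply/eqP; apply/negPn/negP => l0.
(* This [r] gives the affine function the value 1. *)
have := H ((1 - rinner q.2 q.1) / l).
by rewrite divfK// addrC subrK leNgt ltr01.
Qed.

Lemma skew_opp_sub_adjoint H (dH : densely_defined H) :
  skew_symmetric dH -> extends (adjoint dH) (opp_operator H).
Proof.
by move=> sH [x y] /sH; rewrite /= /opp_graph /= opprK.
Qed.

Lemma adjoint_opp H (dH : densely_defined H) p q :
  graph (opp_operator H) p -> graph (adjoint dH) q ->
  inner p.1 q.2 + inner p.2 q.1 = 0.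
Proof.
move=> Hp /(_ p.1); rewrite (opvalE Hp) linearNl /= => <-.
  by rewrite addNr.
by exists (- p.2).
Qed.

(** Skew-symmetry puts [p] in both graphs of [adjoint_opp]; pairing [p] with itself gives twice the
    real part. *)
Lemma skew_rinner_eq0 H (dH : densely_defined H) p :
  skew_symmetric dH -> graph (opp_operator H) p -> rinner p.2 p.1 = 0.
Proof.
move=> sH Hp; have := adjoint_opp Hp (skew_opp_sub_adjoint sH Hp).
move=> /(congr1 (@complex.Re R)); rewrite raddfD /= -!/(rinner _ _).
by rewrite rinnerC; lra.
Qed.

Lemma dissipative_extension_sub_adjoint H (dH : densely_defined H) K :
  skew_symmetric dH -> dissipative K -> extends K (opp_operator H) ->
  extends (adjoint dH) K.
Proof.
move=> sH dK HK q Kq x Hx.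
pose p := (x, - H x).
have Hp : graph (opp_operator H) p.
  by rewrite /= /opp_graph /= opprK; exact: graph_opval.
pose w := inner p.2 q.1 + inner p.1 q.2.
(* The cross term only controls a real part; scaling [p] by 1 and by [-i] recovers both parts of
   [w]. *)
have w0 (c : R[i]) : complex.Re (c * w) = 0.
  have Hcp := graphZ c Hp.
  have := dissipative_cross_eq0 dK (HK _ Hcp) Kq (skew_rinner_eq0 sH Hcp).
  by rewrite /rinner !linearZl_LR /= -raddfD -mulrDr.
have : w = 0.
  have := w0 1; have := w0 (0 -i* 1); case: (w) => a b /=.
  by rewrite !mul0r !mul1r mulN1r opprK add0r subr0 => -> ->.
by rewrite /w linearNl addrC => /subr0_eq.
Qed.

End operator_graphs.

(** * Green's identity and the boundary map *)

Section boundary_system_theory.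
Context {R : realType} {X : hilbertType R} {H0 : operator X}.
Context {dH0 : densely_defined H0} (sH0 : skew_symmetric dH0).
Context (B : boundary_system dH0).
Context (OmegaE : forall p q, bs_Omega B p q = standard_symmetric p q).
Context (omegaE : forall p q, bs_omega B p q = standard_unitary p q).

Local Notation A := (adjoint dH0).
Local Notation F := (bs_F B).

Implicit Types (p q : X * X) (H : operator X).

Lemma boundary_form p q : graph A p -> graph A q ->
  standard_symmetric p q = standard_unitary (F p) (F q).
Proof.
move=> Ap Aq; rewrite -OmegaE -omegaE.
have := @bs_form _ _ _ _ B p.1 q.1.
rewrite (graph_opvalK Ap) (graph_opvalK Aq); apply.
  by exists p.2; rewrite -surjective_pairing.
by exists q.2; rewrite -surjective_pairing.
Qed.

Lemma boundary_rinner p : graph A p ->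
  2 * rinner p.2 p.1 = sqn (F p).1 - sqn (F p).2.
Proof.
move=> Ap; have := boundary_form Ap Ap.
move=> /(congr1 (@complex.Re R)); rewrite raddfD raddfB /= -!/(rinner _ _).
by rewrite /sqn (rinnerC p.1) => <-; ring.
Qed.

Lemma boundary_dissipative p : graph A p ->
  (rinner p.2 p.1 <= 0) = (`|(F p).1| <= `|(F p).2|).
Proof.
move=> /boundary_rinner Ap; rewrite -ler_sqn -[sqn _ <= _]subr_le0 -Ap.
by rewrite pmulr_rle0.
Qed.

Lemma boundary_lin (a : R[i]) p q : graph A p -> graph A q ->
  F (a *: p + q) = a *: F p + F q.
Proof. exact: bs_F_linear. Qed.

Lemma boundary_scale (a : R[i]) p : graph A p -> F (a *: p) = a *: F p.
Proof.
move=> Ap; have F0 : F 0 = 0.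
  have := boundary_lin (-1) (graph0 A) (graph0 A).
  by rewrite scaler0 addr0 scaleN1r addNr.
by rewrite -[a *: p]addr0 boundary_lin ?F0 ?addr0//; exact: graph0.
Qed.

Lemma boundary_sub p q : graph A p -> graph A q -> F (p - q) = F p - F q.
Proof.
by move=> Ap Aq; rewrite addrC -scaleN1r boundary_lin// scaleN1r addrC.
Qed.

Lemma boundary_surj g : exists2 p, graph A p & F p = g.
Proof. by have [p Ap <-] := @bs_F_surj _ _ _ _ B g I; exists p. Qed.

(** By surjectivity some [q] has the boundary value of [p] with its second component negated. Then
    [omega] becomes a sum of two squared norms, while [Omega] vanishes by [adjoint_opp]. *)
Lemma boundary_opp p : graph (opp_operator H0) p -> F p = 0.
Proof.
move=> Hp; have Ap := skew_opp_sub_adjoint sH0 Hp.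
have [q Aq Fq] := boundary_surj ((F p).1, - (F p).2).
have := boundary_form Ap Aq.
rewrite /standard_symmetric (adjoint_opp Hp Aq) Fq /standard_unitary /=.
rewrite linearNr opprK => /(congr1 (@complex.Re R)).
rewrite raddfD /= -!/(rinner _ _) -!/(sqn _) => /esym E.
have := sqn_ge0 (F p).1; have := sqn_ge0 (F p).2 => F2 F1.
have /sqn_eq0 F10 : sqn (F p).1 = 0 by lra.
have /sqn_eq0 F20 : sqn (F p).2 = 0 by lra.
by rewrite [F p]surjective_pairing F10 F20.
Qed.

(** * Maximal dissipative restrictions and contractions *)

Lemma maximal_dissipative_boundary_mem H p : extends A H ->
  maximal_dissipative H -> graph A p ->
  (forall h (c : R[i]), graph H h ->
    `|(F h + c *: F p).1| <= `|(F h + c *: F p).2|) ->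
  graph H p.
Proof.
move=> HA Hmax Ap Fp; apply: (maximal_dissipative_mem HA Hmax Ap) => h c Hh.
have Ah := HA _ Hh; have Ahcp : graph A (h + c *: p) by exact/graphD/graphZ.
by rewrite boundary_dissipative// [h + _]addrC boundary_lin// addrC; exact: Fp.
Qed.

Lemma maximal_dissipative_boundary_surj H (v : bs_G2 B) : extends A H ->
  maximal_dissipative H -> exists2 p, graph H p & (F p).2 = v.
Proof.
move=> HA Hmax; have [/dissipativeP dH _] := Hmax.
have F_le h : graph H h -> `|(F h).1| <= `|(F h).2|.
  by move=> Hh; rewrite -boundary_dissipative ?dH//; exact: HA.
have [||q [h Hh <-]|t tP] := @contraction_point _ _ _ (F @` graph H) v.
- exists 0; first exact: graph0.
  by rewrite -[X in F X](scale0r 0) boundary_scale ?scale0r//; exact: graph0.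
- move=> a _ _ [p Hp <-] [q Hq <-]; exists (a *: p + q); first exact: graphP.
  by rewrite boundary_lin//; exact: HA.
- exact: F_le.
have [p Ap Fp] := boundary_surj (t, v).
exists p; last by rewrite Fp.
apply: maximal_dissipative_boundary_mem Ap _ => // h c Hh; rewrite Fp.
have [->|c0] := eqVneq c 0; first by rewrite scale0r addr0; exact: F_le.
(* Factoring out [c] reduces the bound to the choice of [t], applied to a multiple of [h]. *)
have -> : F h + c *: (t, v) = c *: ((t, v) - F (- c^-1 *: h)).
  rewrite boundary_scale; last exact: HA.
  by rewrite scaleNr opprK scalerDr scalerA divff// scale1r addrC.
rewrite /= !normrZ ler_wpM2l//; apply: (tP (F (- c^-1 *: h))).
by exists (- c^-1 *: h) => //; exact: graphZ.
Qed.

Lemma maximal_dissipative_contraction H : extends A H ->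
  maximal_dissipative H ->
  exists T : {linear bs_G2 B -> bs_G1 B}, contraction_operator T /\
    forall p, graph H p -> (F p).1 = T (F p).2.
Proof.
move=> HA Hmax; have [/dissipativeP dH _] := Hmax.
have F_le h : graph H h -> `|(F h).1| <= `|(F h).2|.
  by move=> Hh; rewrite -boundary_dissipative ?dH//; exact: HA.
have [v|f fP] := @choice _ _ (fun v p => graph H p /\ (F p).2 = v).
  have [p Hp pv] := maximal_dissipative_boundary_surj v HA Hmax.
  by exists p.
pose T0 v := (F (f v)).1.
(* Independence of the chosen preimage: if second components agree, the bound on the difference
   forces the first ones to agree. Linearity follows. *)
have T0E p : graph H p -> (F p).1 = T0 (F p).2.
  move=> Hp; have [Hf fE] := fP (F p).2.
  have := F_le _ (graphB Hp Hf).
  rewrite boundary_sub /=; [|exact: HA..].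
  by rewrite fE subrr normr0 normr_le0 subr_eq0 => /eqP.
have T0lin : linear T0.
  move=> a u v; have [[Hu uE] [Hv vE]] := (fP u, fP v).
  have := T0E _ (graphP a Hu Hv).
  by rewrite boundary_lin /=; [rewrite uE vE|exact: HA..].
pose T : {linear bs_G2 B -> bs_G1 B} :=
  HB.pack T0 (GRing.isLinear.Build _ _ _ _ T0 T0lin).
exists T; split=> // v; have [Hv vE] := fP v.
by rewrite -[X in _ <= `|X|]vE; exact: F_le.
Qed.

Lemma contraction_maximal_dissipative H (T : {linear bs_G2 B -> bs_G1 B}) :
  contraction_operator T ->
  (forall p, graph H p <-> graph A p /\ (F p).1 = T (F p).2) ->
  maximal_dissipative H /\ extends H (opp_operator H0).
Proof.
move=> Tc HE.
have H0H : extends H (opp_operator H0).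
  move=> p Hp; apply/HE; split; first exact: skew_opp_sub_adjoint.
  by rewrite boundary_opp//; exact: (esym (linear0 T)).
split=> //; split.
  apply/dissipativeP => p /HE[Ap Fp].
  by rewrite boundary_dissipative// Fp; exact: Tc.
move=> K dK HK; apply: operator_ext; apply/seteqP; split; last exact: HK.
move=> p Kp; have KA : extends A K.
  by apply: dissipative_extension_sub_adjoint => // q /H0H /HK.
have Ap := KA _ Kp; apply/HE; split=> //.
have [q Aq Fq] := boundary_surj (T (F p).2, (F p).2).
have Hq : graph H q by apply/HE; rewrite Fq.
have Kpq : graph K (p - q) by apply: graphB => //; exact: HK.
have := (dissipativeP K).1 dK _ Kpq.
rewrite boundary_dissipative; last exact: KA.
by rewrite boundary_sub// Fq /= subrr normr0 normr_le0 subr_eq0 => /eqP.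
Qed.

End boundary_system_theory.

Theorem theorem2p1 (R : realType) (X : hilbertType R) (H0 : operator X)
    (dH0 : densely_defined H0) (cH0 : closed_operator H0)
    (sH0 : skew_symmetric dH0) (B : boundary_system dH0)
    (OmegaE : forall p q, bs_Omega B p q = standard_symmetric p q)
    (omegaE : forall p q, bs_omega B p q = standard_unitary p q)
    (H : operator X) (HA : extends (adjoint dH0) H) :
  (maximal_dissipative H /\ extends H (opp_operator H0)) <->
  exists T : {linear bs_G2 B -> bs_G1 B},
    contraction_operator T /\
    dom H = [set x | dom (adjoint dH0) x /\ bs_F1 B x = T (bs_F2 B x)].
Proof.
split=> [[Hmax _]|[T [Tc domH]]].
  have [T [Tc TE]] := maximal_dissipative_contraction OmegaE omegaE HA Hmax.
  exists T; split=> //; apply/seteqP; split=> [x Hx|x [Ax Fx]].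
    have Hxx := graph_opval Hx.
    have Axx := HA _ Hxx; split; first by exists (H x).
    by have := TE _ Hxx; rewrite -(graph_opvalK Axx).
  have Axx := graph_opval Ax; exists (adjoint dH0 x).
  (* Boundary values of [h] and [x] lie on the graph of [T], hence so do their combinations, and [T]
     is a contraction. *)
  apply: (maximal_dissipative_boundary_mem OmegaE omegaE HA Hmax Axx) => h c Hh.
  rewrite /bs_F1 /bs_F2 in Fx.
  by rewrite /= (TE _ Hh) Fx -linearZ -linearD; exact: Tc.
apply: (contraction_maximal_dissipative sH0 OmegaE omegaE Tc) => p.
split=> [Hp|].
  have Ap := HA _ Hp; split=> //.
  have : dom H p.1 by exists p.2; rewrite -surjective_pairing.
  by rewrite domH /= /bs_F1 /bs_F2 (graph_opvalK Ap) => -[].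
move=> [Ap Fp].
have : dom H p.1.
  rewrite domH; split; first by exists p.2; rewrite -surjective_pairing.
  by rewrite /bs_F1 /bs_F2 (graph_opvalK Ap).
move=> /graph_opval Hp.
by have := graph_opvalK Ap; rewrite (opvalE (HA _ Hp)) => <-.
Qed.
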